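(* Let $G$ be a group, let $S$ be a finite transitive right $G$-set with $n = |S|$, let $F$ be an arbitrary field, and let $M \subseteq F[S]$ be an arbitrary nonzero $G$-submodule. Then there exists a nonzero vector $v \in M$ such that $$t + d \le n + 1,$$ where $t = |\mathrm{supp}(v)|$ and $d = \dim_F(\langle v\rangle)$.
   Context: For a field $F$ and a right $G$-set $S$, $F[S]$ denotes the permutation module: the $F$-vector space of (finite) formal $F$-linear combinations of elements of $S$, with the right action of $G$ on $S$ extended linearly to $F[S]$. For $v\in F[S]$, $\mathrm{supp}(v)$ is the set of points of $S$ that occur with nonzero coefficient in $v$, and $\langle v\rangle$ is the $G$-submodule of $F[S]$ generated by $v$, i.e. the $F$-linear span of the translates $vg$, $g\in G$. *)

(* Defs.v *)
From HB Require Import structures.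
From mathcomp Require Import all_boot all_order all_algebra all_fingroup.
From mathcomp Require Import boolp.
Set Implicit Arguments. Unset Strict Implicit. Unset Printing Implicit Defensive.
Import GRing.Theory.
Local Open Scope ring_scope.

(* MathComp's [action] requires a finGroupType; here G may be infinite. *)
Record right_gset (G : groupType) (S : Type) := RightGSet {
  ract :> S -> G -> S;
  ract1 : forall s, ract s 1%g = s;
  ractM : forall s g h, ract s (g * h)%g = ract (ract s g) h }.

Definition transitive_gset (G : groupType) (S : Type) (to : right_gset G S) :=
  forall s t : S, exists g : G, to s g = t.

(* F[S] for finite S: a vector is its coefficient function. *)
Notation permmod F S := {ffun S -> F^o}.

Definition point (F : fieldType) (S : finType) (s : S) : permmod F S :=
  [ffun t => (t == s)%:R].

Definition translate (G : groupType) (S : finType) (to : right_gset G S)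
    (F : fieldType) (v : permmod F S) (g : G) : permmod F S :=
  \sum_(s : S) v s *: point F (to s g).

Definition supp (F : fieldType) (S : finType) (v : permmod F S) : {set S} :=
  [set s | v s != 0].

Definition submodule (G : groupType) (S : finType) (to : right_gset G S)
    (F : fieldType) (M : {vspace permmod F S}) :=
  forall v g, v \in M -> translate to v g \in M.

Definition translate_comb (G : groupType) (S : finType) (to : right_gset G S)
    (F : fieldType) (v w : permmod F S) :=
  exists r : seq (F * G), w = \sum_(c <- r) c.1 *: translate to v c.2.

Lemma vspace_of_pred (F : fieldType) (vT : vectType F) (P : vT -> Prop) :
  P 0 -> (forall a u w, P u -> P w -> P (a *: u + w)) ->
  exists V : {vspace vT}, forall w, w \in V <-> P w.
Proof.
move=> P0 PL.
have key k (V : {vspace vT}) : (\dim {:vT} - \dim V <= k)%N ->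
    (forall w, w \in V -> P w) ->
    exists W : {vspace vT}, forall w, w \in W <-> P w.
  elim: k V => [|k IHk] V leVk sVP.
    exists V => w; split=> [/sVP//|_].
    suff -> : V = fullv by exact: memvf.
    by apply/eqP; rewrite eqEdim subvf -subn_eq0 -leqn0.
  have [[u [Pu V'u]]|noU] := pselect (exists u, P u /\ u \notin V).
    apply: (IHk (<[u]> + V)%VS) => [|w].
      have ltV : (\dim V < \dim (<[u]> + V))%N.
        rewrite ltnNge; apply: contra V'u => leV.
        have /eqP-> : V == (<[u]> + V)%VS by rewrite eqEdim addvSr.
        by rewrite memvE addvSl.
      have leF := dimvS (subvf (<[u]> + V)).
      rewrite -ltnS; apply: leq_trans leVk.
      by apply: ltn_sub2l => //; apply: leq_trans ltV leF.
    by case/memv_addP=> _ /vlineP[a ->] [x /sVP Px ->]; apply: PL.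
  exists V => w; split=> [/sVP//|Pw].
  by apply: contrapT => /negP V'w; apply: noU; exists w.
apply: (key _ 0%VS (leqnn _)) => w; rewrite memv0 => /eqP-> //.
Qed.

Lemma cyclic_submodule_ex (G : groupType) (S : finType) (to : right_gset G S)
    (F : fieldType) (v : permmod F S) :
  exists V : {vspace permmod F S}, forall w, w \in V <-> translate_comb to v w.
Proof.
apply: vspace_of_pred => [|a u w [r ->] [r' ->]].
  by exists [::]; rewrite big_nil.
exists ([seq (a * c.1, c.2) | c <- r] ++ r').
rewrite big_cat big_map scaler_sumr; congr (_ + _).
by apply: eq_bigr => c _; rewrite scalerA.
Qed.

(* <v>: the subspace whose elements are exactly the F-linear combinations of
   the translates of v (unique, since subspaces are extensional). *)
Definition cyclic_submodule (G : groupType) (S : finType) (to : right_gset G S)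
    (F : fieldType) (v : permmod F S) : {vspace permmod F S} :=
  sval (cid (cyclic_submodule_ex to v)).

Lemma cyclic_submoduleP (G : groupType) (S : finType) (to : right_gset G S)
    (F : fieldType) (v w : permmod F S) :
  w \in cyclic_submodule to v <-> translate_comb to v w.
Proof. exact: (svalP (cid (cyclic_submodule_ex to v))). Qed.

(* Main.v *)
Require Import Defs.
From HB Require Import structures.
From mathcomp Require Import all_boot all_order all_algebra all_fingroup.
Set Implicit Arguments. Unset Strict Implicit. Unset Printing Implicit Defensive.
Local Open Scope ring_scope.

(* Let m = dim M.  Vanishing at m - 1 prescribed points of S imposes m - 1
   linear conditions, so some nonzero v in M satisfies them; then
   |supp v| <= n - (m - 1), while <v> is contained in M and has dimension
   at most m. *)

(** Evaluation at the points of [A] is linear into a space of dimension [#|A|], too small for it to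
    be injective on [V]. *)
Lemma exists_vanishing (F : fieldType) (S : finType) (V : {vspace permmod F S})
    (A : {set S}) :
  (#|A| < \dim V)%N ->
  exists v : permmod F S, [/\ v \in V, v <> 0 & forall s, s \in A -> v s = 0].
Proof.
move=> ltAV; pose ev (v : permmod F S) : 'rV[F]_#|A| := \row_i v (enum_val i).
have ev_linear : linear ev by move=> a u w; apply/rowP=> i; rewrite !mxE !ffunE.
pose evL := GRing.isLinear.Build F _ _ _ ev ev_linear.
pose f := linfun (HB.pack_for {linear permmod F S -> 'rV[F]_#|A|} ev evL).
have dimker : (0 < \dim (V :&: lker f))%N.
  have le_img : (\dim (f @: V) <= #|A|)%N.
    by rewrite (leq_trans (dimvS (subvf _))) // dimvf /dim /= mul1n.
  (* Rank-nullity for [f] restricted to [V]. *)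
  by rewrite -(ltn_add2r (\dim (f @: V))) limg_ker_dim (leq_ltn_trans le_img).
(* [vpick] gives a nonzero vector because [dimker] makes the intersection nonzero. *)
exists (vpick (V :&: lker f)).
have := memv_pick (V :&: lker f); rewrite memv_cap memv_ker lfunE /=.
case/andP=> Vv /eqP ev0; split=> // [/eqP|s As].
  by rewrite vpick0 -dimv_eq0 -leqn0 leqNgt dimker.
by move/rowP: ev0 => /(_ (enum_rank_in As s)); rewrite !mxE enum_rankK_in.
Qed.

Lemma dim_permmod (F : fieldType) (S : finType) (V : {vspace permmod F S}) :
  (\dim V <= #|S|)%N.
Proof. by rewrite (leq_trans (dimvS (subvf V))) // dimvf /dim /= muln1. Qed.

Lemma cyclic_submodule_sub (G : groupType) (S : finType) (to : right_gset G S)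
    (F : fieldType) (M : {vspace permmod F S}) (v : permmod F S) :
  submodule to M -> v \in M -> (cyclic_submodule to v <= M)%VS.
Proof.
move=> hM Mv; apply/subvP=> w /cyclic_submoduleP[r ->].
by apply: memv_suml => c _; apply/memvZ/hM.
Qed.

Theorem lemmaF (G : groupType) (S : finType) (to : right_gset G S)
    (htrans : transitive_gset to) (F : fieldType)
    (M : {vspace permmod F S}) (hM : submodule to M) (hM0 : M <> 0%VS) :
  exists v : permmod F S,
    [/\ v \in M, v <> 0 &
        (#|supp v| + \dim (cyclic_submodule to v) <= #|S| + 1)%N].
Proof.
(* Positivity makes [(\dim M).-1] a true predecessor, so that a set of that size is strictly smaller
   than [\dim M]. *)
have dimM_gt0 : (0 < \dim M)%N by rewrite lt0n dimv_eq0; apply/eqP.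
have leMS : ((\dim M).-1 <= #|[set: S]|)%N.
  by rewrite cardsT (leq_trans (leq_pred _)) // dim_permmod.
have [A /andP[_ /eqP cardA]] : exists A : {set S},
    (A \subset [set: S]) && (#|A| == (\dim M).-1).
  (* Such an [A] exists by counting: the number of candidates is a binomial coefficient, positive by
     [leMS]. *)
  have : (0 < #|[set A : {set S} | A \subset [set: S] & #|A| == (\dim M).-1]|)%N.
    by rewrite cards_draws bin_gt0.
  by case/card_gt0P=> A; rewrite inE; exists A.
have [|v [Mv v0 vA]] := @exists_vanishing F S M A.
  by rewrite cardA prednK.
exists v; split=> //.
have suppv : (#|supp v| <= #|~: A|)%N.
  apply/subset_leq_card/subsetP=> s; rewrite !inE; apply: contraNN => As.
  by rewrite vA.
have dimv := dimvS (cyclic_submodule_sub hM Mv).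
rewrite (leq_trans (leq_add suppv dimv)) //.
(* What remains is an equality: with m = [\dim M], [#|S|] is m - 1 + [#|~: A|], hence [#|~: A|] + m
   = [#|S|] + 1. *)
by rewrite -(cardsC A) cardA -(prednK dimM_gt0) addnS addn1 ltnS addnC.
Qed.
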